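(* Let $p$ be a prime, let $G$ be a pro-$p$ abelian group and let $R=\mathcal{O}_{\mathbb{C}_p}$. Let $\nu\in R\llbracket G\rrbracket$ be non-zero. Then for every $\varepsilon>0$ there exists a finite subgroup $M_{\nu,\varepsilon}\leq\widehat{G}$ such that the following holds: for any non-trivial finite subgroup $M\leq\widehat{G}$ there exist $\chi\in M$, $\chi\neq\mathbf{1}$, and $\chi_0\in M_{\nu,\varepsilon}$ such that $$v_p(\nu(\chi\chi_0))\leq v_p(\nu)+\varepsilon .$$ Furthermore, if $v_p(\nu(\mathbf{1}))\leq v_p(\nu)+\varepsilon$, then $M_{\nu,\varepsilon}$ can be chosen such that $|M_{\nu,\varepsilon}|\leq p^{\lfloor v_p(\nu(\mathbf{1}))\rfloor}$.
   Context: $\mathcal{O}_{\mathbb{C}_p}=\{x\in\mathbb{C}_p:v_p(x)\ge0\}$, where $v_p$ is the valuation on $\mathbb{C}_p$ with $v_p(p)=1$. $R\llbracket G\rrbracket=\varprojlim_{H\le G\text{ open}}R[G/H]$. $\widehat{G}=\mathrm{Hom}_{\mathrm{cts}}(G,\mathbb{C}_p^\times)$ is the multiplicative group of continuous characters, $\widehat{G}_{\mathrm{tor}}$ its subgroup of finite order characters, and $\mathbf{1}$ the trivial character. For $\chi\in\widehat{G}_{\mathrm{tor}}$, factoring through $G/H$ with $H$ open, $\nu(\chi):=\sum_{x\in G/H}\nu_x\chi(x)$, where $\sum_x\nu_x[x]\in R[G/H]$ is the image of $\nu$. Finally $v_p(\nu):=\inf_{\chi\in\widehat{G}_{\mathrm{tor}}}v_p(\nu(\chi))$.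 *)

(* Defs.v *)
From HB Require Import structures.
From mathcomp Require Import all_boot all_order all_algebra.
From mathcomp Require Import generic_quotient ring_quotient.
From mathcomp Require Import all_classical all_reals all_analysis.

Set Implicit Arguments.
Unset Strict Implicit.
Unset Printing Implicit Defensive.

Import Order.TTheory GRing.Theory Num.Theory.
Import Quotient.

Local Open Scope classical_set_scope.
Local Open Scope ring_scope.
Local Open Scope quotient_scope.

(* Additive valuations with real values on K^*.                               *)
Record valuation (R : realType) (K : fieldType) := Valuation {
  val_fun :> K -> \bar R;
  val_eqy : forall x, val_fun x = +oo%E <-> x = 0;
  val_gtNy : forall x, (-oo < val_fun x)%E;
  valM : forall x y, val_fun (x * y) = (val_fun x + val_fun y)%E;
  valD : forall x y, (mine (val_fun x) (val_fun y) <= val_fun (x + y))%E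
}.

Section ValuationTheory.
Variables (R : realType) (K : fieldType) (v : valuation R K).
Local Open Scope ereal_scope.

Lemma val0 : v 0%R = +oo. Proof. exact/val_eqy. Qed.

Lemma val_fin x : x != 0%R -> v x \is a fin_num.
Proof.
move=> x0; rewrite fin_numE gt_eqF ?val_gtNy//=.
by apply: contra x0 => /eqP/val_eqy ->.
Qed.

Lemma val1 : v 1%R = 0.
Proof.
have := valM v 1 1; rewrite mulr1.
have /fineK <- := val_fin (oner_neq0 K).
by move=> []; rewrite -[LHS]addr0 => /addrI <-.
Qed.

Lemma valN1 : v (- 1)%R = 0.
Proof.
have := valM v (- 1) (- 1); rewrite mulrNN mulr1 val1.
have N1 : (- 1 : K)%R != 0%R by rewrite oppr_eq0 oner_neq0.
have /fineK <- := val_fin N1.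
by move=> [] /esym/eqP; rewrite -mulr2n mulrn_eq0/= => /eqP ->.
Qed.

Lemma valN x : v (- x)%R = v x.
Proof. by rewrite -mulN1r valM valN1 add0e. Qed.

Lemma valB x y : mine (v x) (v y) <= v (x - y)%R.
Proof. by rewrite -(valN y) valD. Qed.

Lemma valB_gt x y c : c < v x -> c < v y -> c < v (x - y)%R.
Proof. by move=> cx cy; apply: lt_le_trans (valB x y); rewrite lt_min cx. Qed.

Lemma val_distC x y : v (x - y)%R = v (y - x)%R.
Proof. by rewrite -valN opprB. Qed.

End ValuationTheory.

(* K endowed with the uniform structure defined by v.                         *)
Definition valued (R : realType) (K : fieldType) (v : valuation R K) : Type := K.

Section ValuedUniform.
Variables (R : realType) (K : fieldType) (v : valuation R K).

Definition val_entourage : set_system (valued v * valued v) :=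
  [set A | exists c : R, forall x y : K, (c%:E < v (x - y)%R)%E -> A (x, y)].

Let val_entourage_filter : Filter val_entourage.
Proof.
split; first by exists 0.
- move=> A B [c cA] [d dB]; exists (Num.max c d) => x y.
  rewrite EFin_max gt_max => /andP[/cA ? /dB ?]; by split.
- by move=> A B AB [c cA]; exists c => x y /cA /AB.
Qed.

Let val_entourage_diag A : val_entourage A -> diagonal `<=` A.
Proof.
move=> [c cA] [x y] /= /diagonalP/= <-; apply: cA.
by rewrite subrr val0 ltry.
Qed.

Let val_entourage_inv A : val_entourage A -> val_entourage (A^-1)%relation.
Proof. by move=> [c cA]; exists c => x y cxy; apply: cA; rewrite val_distC. Qed.

Let val_entourage_split A : val_entourage A ->
  exists2 B, val_entourage B & (B \; B)%relation `<=` A.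
Proof.
move=> [c cA]; exists [set xy : K * K | (c%:E < v (xy.1 - xy.2)%R)%E].
  by exists c.
move=> [x z] /= [y /= cxy cyz]; apply: cA.
by rewrite -(subrKA y) -(opprB z y) valB_gt// val_distC.
Qed.

HB.instance Definition _ := Choice.copy (valued v) K.
HB.instance Definition _ := isPointed.Build (valued v) (0 : K).
HB.instance Definition _ := isUniform.Build (valued v)
  val_entourage_filter val_entourage_diag val_entourage_inv val_entourage_split.

End ValuedUniform.

Lemma nbhs_valuedP (R : realType) (K : fieldType) (v : valuation R K)
    (x : valued v) (A : set (valued v)) :
  nbhs x A <-> exists c : R, forall y : K, (c%:E < v (x - y)%R)%E -> A y.
Proof.
rewrite -nbhs_entourageE; split.
  move=> [B [c cB] BA]; exists c => y cxy; apply: BA; apply/xsectionP.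
  exact: cB.
move=> [c cA].
exists [set xy : K * K | (c%:E < v (xy.1 - xy.2)%R)%E]; first by exists c.
by move=> y /xsectionP /= /cA.
Qed.

Definition valring_pred (R : realType) (K : fieldType) (v : valuation R K) :
  pred K := fun x => (0 <= v x)%E.
Arguments valring_pred {R K} v x /.

Section ValuationRing.
Variables (R : realType) (K : fieldType) (v : valuation R K).

Fact valring_closed : subring_closed (valring_pred v).
Proof.
split=> [|x y|x y]; rewrite !unfold_in /valring_pred.
- by rewrite val1.
- by move=> x0 y0; apply: le_trans (valB v x y); rewrite le_min x0.
- by move=> x0 y0; rewrite valM adde_ge0.
Qed.

HB.instance Definition _ :=
  GRing.isSubringClosed.Build K (valring_pred v) valring_closed.

Record valring := ValRing {
  valring_val :> K;
  valring_valP : valring_val \in valring_pred v }.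

HB.instance Definition _ := [isSub for valring_val].
HB.instance Definition _ := [Choice of valring by <:].
HB.instance Definition _ := [SubChoice_isSubComNzRing of valring by <:].

End ValuationRing.

(* C_p is the completion of an algebraic closure of Q_p, for the valuation    *)
(* normalised by v p = 1. Inside a complete field, Q_p is the closure of the  *)
(* prime field Q; as Cp is algebraically closed, the elements of Cp algebraic *)
(* over Q_p form an algebraic closure of Q_p. Hence the pairs (Cp, v) below   *)
(* are exactly the isometric copies of C_p. The valuation on Q_p is forced by *)
(* v p = 1, and char Cp = 0 follows from it as well.                          *)
Section PadicComplex.
Variables (R : realType) (Cp : closedFieldType) (v : valuation R Cp).

Definition padic_number : set (valued v) :=
  @closure (valued v) (range (@ratr Cp)).

Definition padic_algebraic : set (valued v) :=
  [set x : Cp | exists P : {poly Cp},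
    [/\ P != 0, forall i, padic_number P`_i & root P x]].

Record is_padic_complex (p : nat) : Prop := IsPadicComplex {
  padic_val_p : v p%:R = 1%E;
  padic_complete : forall F : set_system (valued v),
    ProperFilter F -> cauchy F -> cvg F;
  padic_dense : dense padic_algebraic
}.

End PadicComplex.

(* Abelian topological groups are written additively, their character groups  *)
(* multiplicatively.                                                          *)
Record open_subgroup (G : topologicalZmodType) := OpenSubgroup {
  open_subgroup_val :> zmodClosed G;
  open_subgroupP : open [set x | x \in open_subgroup_val]
}.

Record pro_p (p : nat) (G : topologicalZmodType) : Prop := ProP {
  pro_p_compact : compact [set: G];
  pro_p_hausdorff : hausdorff_space G;
  pro_p_disconnected : totally_disconnected [set: G];
  pro_p_index : forall H : open_subgroup G,
    exists n, ([set: {quot H}] #= `I_(p ^ n))%card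
}.

(* A[[G]] as the inverse limit of the A[G/H]. As G/H is finite for the groups *)
(* of interest, an element of A[G/H] is a function {quot H} -> A.             *)
Record completed_group_ring (A : nzRingType) (G : topologicalZmodType) :=
  CompletedGroupRing {
    cgr_coef :> forall H : open_subgroup G, {quot H} -> A;
    cgr_compat : forall (H H' : open_subgroup G), {subset H <= H'} ->
      forall y : {quot H'}, cgr_coef y =
        \sum_(x \in [set x : {quot H} | \pi_({quot H'}) (repr x) = y])
          cgr_coef x
  }.

Definition cgr_nonzero (A : nzRingType) (G : topologicalZmodType)
    (nu : completed_group_ring A G) : Prop :=
  exists (H : open_subgroup G) (x : {quot H}), nu H x != 0.

Section Characters.
Variables (R : realType) (K : fieldType) (v : valuation R K).
Variable G : topologicalZmodType.

(* Continuous homomorphisms G -> K^*; they do not vanish because chi 0 = 1,   *)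
(* and the topology of K^* is induced by that of K.                           *)
Record character := Character {
  char_fun :> G -> K;
  char0 : char_fun 0 = 1;
  charD : forall x y, char_fun (x + y) = char_fun x * char_fun y;
  char_continuous : continuous (char_fun : G -> valued v)
}.

HB.instance Definition _ := gen_eqMixin character.
HB.instance Definition _ := gen_choiceMixin character.

Lemma char_eq (chi psi : character) : chi =1 psi -> chi = psi.
Proof.
case: chi psi => [f f0 fD fc] [g g0 gD gc] /= /funext fg.
by subst g; congr Character; exact: Prop_irrelevance.
Qed.

Lemma char_neq0 (chi : character) x : chi x != 0.
Proof.
apply/eqP => chix; have := char0 chi.
by rewrite -(subrr x) charD chix mul0r => /eqP; rewrite eq_sym oner_eq0.
Qed.

Lemma charN (chi : character) x : chi (- x) = (chi x)^-1.
Proof.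
by apply: (mulfI (char_neq0 chi x)); rewrite -charD subrr char0 divff// char_neq0.
Qed.

Fact char_one_continuous : continuous ((fun=> 1) : G -> valued v).
Proof. by move=> x; exact: cvg_cst. Qed.

Definition char_one : character :=
  @Character (fun=> 1) erefl (fun _ _ => esym (mulr1 1)) char_one_continuous.

Fact char_inv_continuous (chi : character) :
  continuous ((fun x => (chi x)^-1) : G -> valued v).
Proof.
suff -> : (fun x => (chi x)^-1) = chi \o -%R.
  move=> x.
  apply: (@continuous_comp G G (valued v) -%R (chi : G -> valued v)).
    exact: opp_continuous.
  exact: (@char_continuous chi).
by apply/funext => x /=; rewrite charN.
Qed.

Fact char_inv0 (chi : character) : (chi 0)^-1 = 1.
Proof. by rewrite char0 invr1. Qed.

Fact char_invD (chi : character) x y :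
  (chi (x + y))^-1 = (chi x)^-1 * (chi y)^-1.
Proof. by rewrite charD invfM. Qed.

Definition char_inv (chi : character) : character :=
  Character (char_inv0 chi) (char_invD chi) (@char_inv_continuous chi).

Fact char_mul_continuous (chi psi : character) :
  continuous ((fun x => chi x * psi x) : G -> valued v).
Proof.
move=> x A /nbhs_valuedP[c cA].
set a := fine (v (chi x)); set b := fine (v (psi x)).
have aE : v (chi x) = a%:E by rewrite fineK// val_fin// char_neq0.
have bE : v (psi x) = b%:E by rewrite fineK// val_fin// char_neq0.
have chi_near (d : R) : \forall y \near x, (d%:E < v (chi x - chi y)%R)%E.
  apply: (@char_continuous chi x [set z : K | (d%:E < v (chi x - z)%R)%E]).
  by apply/nbhs_valuedP; exists d.
have psi_near (d : R) : \forall y \near x, (d%:E < v (psi x - psi y)%R)%E.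
  apply: (@char_continuous psi x [set z : K | (d%:E < v (psi x - z)%R)%E]).
  by apply/nbhs_valuedP; exists d.
suff : \forall y \near x, A (chi y * psi y) by [].
near=> y; apply: cA.
have -> : chi x * psi x - chi y * psi y =
    psi x * (chi x - chi y) - chi y * (psi y - psi x).
  by rewrite !mulrBr opprB addrA (mulrC (psi x) (chi y)) addrNK mulrC.
have dchi : ((c - b)%:E < v (chi x - chi y)%R)%E by near: y; exact: chi_near.
have achi : (a%:E < v (chi x - chi y)%R)%E by near: y; exact: chi_near.
have dpsi : ((c - a)%:E < v (psi x - psi y)%R)%E by near: y; exact: psi_near.
apply: valB_gt; rewrite valM.
  by rewrite bE -[c](subrK b) addrC EFinD lteD2lE.
have aley : (a%:E <= v (chi y))%E.
  have -> : chi y = chi x - (chi x - chi y) by rewrite subKr.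
  by apply: le_trans (valB _ _ _); rewrite le_min aE lexx ltW.
rewrite val_distC; apply: lt_le_trans (leeD2r _ aley).
by rewrite -[c](subrK a) addrC EFinD lteD2lE.
Unshelve. all: by end_near.
Qed.

Fact char_mul0 (chi psi : character) : chi 0 * psi 0 = 1.
Proof. by rewrite !char0 mulr1. Qed.

Fact char_mulD (chi psi : character) x y :
  chi (x + y) * psi (x + y) = (chi x * psi x) * (chi y * psi y).
Proof. by rewrite !charD mulrACA. Qed.

Definition char_mul (chi psi : character) : character :=
  Character (char_mul0 chi psi) (char_mulD chi psi)
    (@char_mul_continuous chi psi).

Fact char_mulA : associative char_mul.
Proof. by move=> a b c; apply: char_eq => x /=; rewrite mulrA. Qed.
Fact char_mul1g : left_id char_one char_mul.
Proof. by move=> a; apply: char_eq => x /=; rewrite mul1r. Qed.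
Fact char_mulg1 : right_id char_one char_mul.
Proof. by move=> a; apply: char_eq => x /=; rewrite mulr1. Qed.
Fact char_mulVg : left_inverse char_one char_inv char_mul.
Proof. by move=> a; apply: char_eq => x /=; rewrite mulVf// char_neq0. Qed.
Fact char_mulgV : right_inverse char_one char_inv char_mul.
Proof. by move=> a; apply: char_eq => x /=; rewrite mulfV// char_neq0. Qed.

HB.instance Definition _ := isGroup.Build character
  char_mulA char_mul1g char_mulg1 char_mulVg char_mulgV.

Definition torsion_char : set character :=
  [set chi | exists n, (0 < n)%N /\ (chi ^+ n = 1)%g].

Definition finite_subgroup (M : set character) : Prop :=
  finite_set M /\ group_closed (mem M).

(* The value of nu at chi, computed in any G/H through which chi factors; by  *)
(* cgr_compat it does not depend on H when G is profinite.                    *)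
Definition cgr_eval (nu : completed_group_ring (valring v) G)
    (chi : character) : K :=
  xget 0 [set z | exists2 H : open_subgroup G,
    (forall x, x \in H -> chi x = 1) &
    z = \sum_(x \in [set: {quot H}]) (nu H x : K) * chi (repr x)].

Definition cgr_val (nu : completed_group_ring (valring v) G) : \bar R :=
  ereal_inf [set v (cgr_eval nu chi) | chi in torsion_char].

End Characters.

(* Main.v *)
(* Fix a torsion character psi with v(nu(psi)) <= c, and say that a finite
   subgroup M avoids psi if v(nu(chi psi)) > c for all nontrivial chi in M.
   The sum of nu(chi psi) over chi in M is |M| times an integral element, and
   its term at chi = 1 is the one of least valuation when M avoids psi; hence
   v(|M|) <= v(nu(psi)). Take M0 avoiding psi, of maximal order p^k. If M0 did
   not work for some nontrivial finite M, then a subgroup C of order p of M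
   would meet M0 trivially and C M0 would avoid psi, with order p^(k+1). For
   psi = 1 this gives k <= v(nu(1)); for the general statement, choose psi
   with v(nu(psi)) < v(nu) + eps and enlarge M0 by the powers of psi. That
   v(nu) is finite amounts to nu(chi) <> 0 for some torsion chi: otherwise the
   functions on G/H orthogonal to all characters form a nonzero translation-
   stable space, which contains a common eigenvector of the translations, i.e.
   a multiple of a character. *)

Require Import Defs.
From HB Require Import structures.
From mathcomp Require Import all_boot all_order all_algebra.
From mathcomp Require Import finmap.
From mathcomp Require Import generic_quotient ring_quotient.
From mathcomp Require Import all_classical all_reals all_analysis.

Set Implicit Arguments.
Unset Strict Implicit.
Unset Printing Implicit Defensive.

Import Order.TTheory GRing.Theory Num.Theory.
(* Again Defs, whose [val1] and [valM] are shadowed by those of mathcomp. *)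
Import Defs Quotient.
Local Open Scope classical_set_scope.
Local Open Scope ring_scope.
Local Open Scope quotient_scope.

(** * Valuations *)

Section Valuations.
Variables (R : realType) (K : fieldType) (v : valuation R K).

Lemma val_sum_ge (I : Type) (r : seq I) (P : pred I) (F : I -> K) (a : \bar R) :
  (forall i, P i -> (a <= v (F i))%E) -> (a <= v (\sum_(i <- r | P i) F i)%R)%E.
Proof.
move=> aF; apply: (big_ind (fun x => a <= v x)%E) => //.
  by rewrite val0 leey.
by move=> x y ax ay; apply: le_trans (valD v x y); rewrite le_min ax.
Qed.

Lemma val_fsum_ge (I : choiceType) (P : set I) (F : I -> K) (a : \bar R) :
  (forall i, P i -> (a <= v (F i))%E) -> (a <= v (\sum_(i \in P) F i)%R)%E.
Proof.
move=> aF; case: finite_supportP => [|X XP _ _].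
  by rewrite big_nil val0 leey.
by rewrite big_seq; apply: val_sum_ge => i /XP /aF.
Qed.

(** The hypothesis [a < +oo] takes care of the empty sum, whose valuation is [+oo]. *)
Lemma val_fsum_gt (I : choiceType) (P : set I) (F : I -> K) (a : \bar R) :
  (a < +oo)%E -> (forall i, P i -> (a < v (F i))%E) ->
  (a < v (\sum_(i \in P) F i)%R)%E.
Proof.
move=> ay aF; case: finite_supportP => [|X XP _ _].
  by rewrite big_nil val0.
rewrite big_seq; apply: (big_ind (fun x => a < v x)%E).
- by rewrite val0.
- by move=> x y ax ay'; apply: lt_le_trans (valD v x y); rewrite lt_min ax.
- by move=> i /XP /aF.
Qed.

Lemma valX x n : v (x ^+ n) = (v x *+ n)%E.
Proof.
elim: n => [|n IHn]; first by rewrite expr0 val1.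
by rewrite exprS valM IHn; case: n {IHn} => [|n]; rewrite ?adde0.
Qed.

Lemma val_nat_ge0 n : (0 <= v n%:R)%E.
Proof. by rewrite -[n]card_ord -sumr_const; apply: val_sum_ge => i _;
  rewrite val1. Qed.

Lemma val_unity_root x n : (0 < n)%N -> x ^+ n = 1 -> v x = 0%E.
Proof.
case: n => // n _ xn.
have x0 : x != 0 by apply/eqP => x0; move/eqP: xn;
  rewrite x0 expr0n/= eq_sym oner_eq0.
have := valX x n.+1; rewrite xn val1.
rewrite -(fineK (val_fin v x0)) -EFin_natmul => -[] /esym/eqP.
by rewrite mulrn_eq0/= => /eqP ->.
Qed.

(** If $x\neq1$, the powers $x^i$ with $i<n$ sum to $0$, so $n=\sum_{i<n}(1-x^i)$. Each term is
    $x-1$ times an integral element, whence $v(n)\geq v(x-1)$. *)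
Lemma unity_root_isolated x n : n%:R != 0 :> K -> x ^+ n = 1 ->
  (v n%:R < v (x - 1)%R)%E -> x = 1.
Proof.
case: n => [|n]; first by rewrite eqxx.
move=> n0 xn; apply: contraPeq => x1; rewrite -subr_eq0 in x1; apply/negP.
rewrite -leNgt.
have /eqP : (x - 1) * (\sum_(i < n.+1) x ^+ i) = 0 by rewrite -subrX1 xn subrr.
rewrite mulf_eq0 (negbTE x1)/= => /eqP sx.
have -> : n.+1%:R = \sum_(i < n.+1) (1 - x ^+ i).
  by rewrite sumrB sx subr0 sumr_const card_ord.
apply: val_sum_ge => i _; rewrite (val_distC v 1) subrX1 valM leeDl//.
by apply: val_sum_ge => j _; rewrite valX (val_unity_root _ xn)// -EFin_natmul
  mul0rn.
Qed.

Section ResidueCharacteristic.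
Variable p : nat.
Hypothesis (vp : v p%:R = 1%E).

Lemma val_pX k : v (p ^ k)%:R = k%:R%:E.
Proof. by rewrite natrX valX vp -EFin_natmul. Qed.

(** The prime $p$ is nonzero since $v(p)=1$. If an $m$ prime to $p$ vanished in [K], a Bezout
    relation would give $ap=1$, whereas $v(ap)\geq1$. *)
Lemma nat_neq0_val n : prime p -> (0 < n)%N -> n%:R != 0 :> K.
Proof.
move=> p_pr n_gt0.
have p0 : p%:R != 0 :> K by apply/eqP => /(congr1 v); rewrite vp val0.
have [m pm ->] := pfactor_coprime p_pr n_gt0.
rewrite natrM natrX mulf_neq0 ?expf_neq0//.
apply/eqP => m0; case: (@egcdnP p m (prime_gt0 p_pr)) => a b;
  rewrite (eqP pm) => pa _.
have := val1 v; have -> : 1 = (a%:R * p%:R : K).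
  by rewrite -natrM pa natrD natrM m0 mulr0 add0r.
rewrite valM vp => av; have := leeD2r 1%E (val_nat_ge0 a).
by rewrite av add0e lee_fin ler10.
Qed.
End ResidueCharacteristic.
End Valuations.

(** * Open subgroups, characters and evaluation *)

Section OpenSubgroups.
Variable G : topologicalZmodType.
Implicit Types H : open_subgroup G.

Lemma cvg_subr (x : G) : (fun y : G => y - x) @ x --> (0 : G).
Proof.
rewrite -[X in _ --> X](subrr x).
apply: (@continuous_comp _ _ _ (fun y : G => (y, x))
  (fun z : G * G => z.1 - z.2)); last exact: sub_continuous.
by apply: cvg_pair; [exact: cvg_id|exact: cvg_cst].
Qed.

Lemma open_subgroup_near H x : \forall y \near x, y - x \in H.
Proof.
apply: (@cvg_subr x [set y | y \in H]); apply: open_nbhs_nbhs.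
by split; [exact: open_subgroupP|rewrite /= rpred0].
Qed.

Lemma zmod_closed_open (S : zmodClosed G) :
  (\forall y \near (0 : G), y \in S) -> open [set x | x \in S].
Proof.
move=> S0; rewrite openE => x /= xS.
suff : \forall y \near x, y \in S by [].
near=> y; rewrite -(subrK x y) rpredD//.
by near: y; exact: (@cvg_subr x [set y | y \in S]).
Unshelve. all: by end_near.
Qed.

Section Intersection.
Variables H1 H2 : open_subgroup G.

(** Intersections provide a common refinement of two levels $G/H_1$ and $G/H_2$. *)
Definition subgroupI : {pred G} := [pred x | (x \in H1) && (x \in H2)].

Fact subgroupI_zmod_closed : zmod_closed subgroupI.
Proof.
split=> [|x y]; rewrite !inE ?rpred0// => /andP[? ?] /andP[? ?].
by rewrite !rpredB.
Qed.

HB.instance Definition _ := GRing.isZmodClosed.Build G subgroupI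
  subgroupI_zmod_closed.

Fact subgroupI_open : open [set x | x \in subgroupI].
Proof.
rewrite (_ : [set _ | _] = [set x | x \in H1] `&` [set x | x \in H2]).
  by apply: openI; exact: open_subgroupP.
by apply/seteqP; split=> x /=; rewrite inE => /andP.
Qed.

Definition open_subgroupI := OpenSubgroup subgroupI_open.

End Intersection.

Lemma pi_quotE H x y : (\pi_({quot H}) x == \pi_({quot H}) y) = (x - y \in H).
Proof. by rewrite Quotient.idealrBE. Qed.

Lemma repr_pi_sub H x : repr (\pi_({quot H}) x) - x \in H.
Proof. by rewrite -pi_quotE reprK. Qed.

End OpenSubgroups.

(** * Characters and their open kernels *)

Section Characters.
Variables (R : realType) (K : fieldType) (v : valuation R K).
Variable G : topologicalZmodType.
Implicit Types (H : open_subgroup G) (chi : character v G).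

(** Such an [f] is constant on the cosets of [H], which are open. *)
Lemma factor_continuous H (f : G -> K) :
  (forall x y, y \in H -> f (x + y) = f x) -> continuous (f : G -> valued v).
Proof.
move=> fH x A Afx; suff : \forall y \near x, A (f y) by [].
have /nbhs_singleton := Afx => Ax.
near=> y; have yx : y - x \in H by near: y; exact: open_subgroup_near.
by rewrite -(subrKC x y) fH.
Unshelve. all: by end_near.
Qed.

Lemma char_mulE chi psi x : (chi * psi)%g x = chi x * psi x. Proof. by []. Qed.

Lemma char1E x : (1%g : character v G) x = 1. Proof. by []. Qed.

Lemma charXE chi n x : (chi ^+ n)%g x = chi x ^+ n.
Proof. by elim: n => [|n IHn]; rewrite ?expr0// exprS -IHn expgS. Qed.

Lemma char_mulC chi psi : (chi * psi = psi * chi)%g.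
Proof. by apply: char_eq => x; rewrite !char_mulE mulrC. Qed.

Lemma char_reprE H chi x : (forall y, y \in H -> chi y = 1) ->
  chi (repr (\pi_({quot H}) x)) = chi x.
Proof.
move=> chiH; rewrite -(subrK x (repr _)) charD chiH ?mul1r//.
exact: repr_pi_sub.
Qed.

Lemma char_reprD H chi (x y : {quot H}) : (forall z, z \in H -> chi z = 1) ->
  chi (repr (x + y)) = chi (repr x) * chi (repr y).
Proof.
move=> chiH; rewrite -{1}[x]reprK -{1}[y]reprK.
by rewrite -(raddfD \pi_({quot H})) char_reprE// charD.
Qed.

Section Torsion.
Hypothesis natK_neq0 : forall n, (0 < n)%N -> n%:R != 0 :> K.

Section Kernel.
Variable chi : character v G.

Definition char_ker : {pred G} := [pred x | chi x == 1].

Fact char_ker_zmod_closed : zmod_closed char_ker.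
Proof.
split=> [|x y]; rewrite !inE ?char0// => /eqP cx /eqP cy.
by rewrite charD charN cx cy divr1.
Qed.

HB.instance Definition _ := GRing.isZmodClosed.Build G char_ker
  char_ker_zmod_closed.

(** The values of [chi] are $n$-th roots of unity, among which $1$ is isolated. By continuity [chi]
    is $1$ near $0$, and a subgroup containing a neighbourhood of $0$ is open. *)
Lemma torsion_char_open_ker : torsion_char chi ->
  exists H, forall x, x \in H -> chi x = 1.
Proof.
move=> [n [n_gt0 chin]].
suff ker_open : open [set x | x \in char_ker].
  by exists (OpenSubgroup ker_open) => x /=; rewrite inE => /eqP.
apply: zmod_closed_open.
have vn : v n%:R \is a fin_num by rewrite val_fin// natK_neq0.
have : nbhs (chi 0 : valued v) [set z : K | (v n%:R < v (chi 0 - z)%R)%E].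
  by apply/nbhs_valuedP; exists (fine (v n%:R)) => z; rewrite fineK.
move=> /(@char_continuous _ _ _ _ chi 0) ?.
suff : \forall y \near (0 : G), chi y = 1.
  by apply: filterS => y cy; apply/eqP.
near=> y; have cy : (v n%:R < v (chi 0 - chi y)%R)%E by near: y.
apply: (@unity_root_isolated _ _ v _ n).
- exact: natK_neq0.
- by rewrite -charXE chin.
- by rewrite val_distC -[X in (X - _)%R](char0 chi).
Unshelve. all: by end_near.
Qed.

End Kernel.

Lemma common_open_ker (M : set (character v G)) :
  finite_set M -> M `<=` @torsion_char _ _ v G ->
  exists H, forall chi, M chi -> forall x, x \in H -> chi x = 1.
Proof.
move=> /finite_seqP[s ->]; elim: s => [|psi s IHs] Mtor.
  have [|H _] := @torsion_char_open_ker 1%g; first by exists 1%N.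
  by exists H.
have [|H1 H1P] := IHs.
  by move=> chi /= chis; apply: Mtor; rewrite /= inE chis orbT.
have [|H2 H2P] := @torsion_char_open_ker psi.
  by apply: Mtor; rewrite /= mem_head.
exists (open_subgroupI H1 H2) => chi /=; rewrite inE => /predU1P[->|chis] x.
  by move=> /andP[_ /H2P].
by move=> /andP[/(H1P _ chis)].
Qed.

End Torsion.
End Characters.

(** * Sums and products over finite groups *)

Lemma fprod_const (K : comNzRingType) (I : choiceType) (A : set I) (x : K) :
  finite_set A -> \big[*%R/1]_(i \in A) x = x ^+ #|` fset_set A|%fset.
Proof.
by move=> Afin; rewrite fsbig_finite//= big_const_seq count_predT
  GRing.iter_mulr_1.
Qed.

Lemma fsum_const (K : zmodType) (I : choiceType) (A : set I) (x : K) :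
  finite_set A -> \sum_(i \in A) x = x *+ #|` fset_set A|%fset.
Proof.
by move=> Afin; rewrite fsbig_finite//= big_const_seq count_predT
  GRing.iter_addr_0.
Qed.

(** Both sides are the sum over the pairs $(x,y)$ with $q(x)=y$. For [q] the projection $G/H\to
    G/H'$, this turns the compatibility of coefficients into one of values. *)
Lemma fsum_fiber (K : idomainType) (I J : choiceType) (q : I -> J) (F : I -> K)
    (g : J -> K) : finite_set [set: I] -> finite_set [set: J] ->
  \sum_(y \in [set: J]) (\sum_(x \in [set x | q x = y]) F x) * g y =
  \sum_(x \in [set: I]) F x * g (q x).
Proof.
move=> Ifin Jfin.
transitivity (\sum_(y \in [set: J]) \sum_(x \in [set: I])
    if q x == y then F x * g y else 0).
  apply: eq_fsbigr => y _; rewrite mulr_fsuml -(setTI [set x | _])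
    fsbig_mkcondr.
  apply: eq_fsbigr => x _.
  by have -> : (x \in [set x | q x = y]) = (q x == y) by apply/idP/eqP;
    rewrite inE.
rewrite exchange_fsbig//; apply: eq_fsbigr => x _.
rewrite -(fsbig_set1 +%R (q x) (fun y => F x * g y)) -(setTI [set q x]).
rewrite fsbig_mkcondr; apply: eq_fsbigr => y _.
by have -> : (y \in [set q x]) = (q x == y) by apply/idP/eqP; rewrite inE.
Qed.

Lemma zmod_addl_bij (Q : zmodType) (x : Q) : bijective (fun y => x + y).
Proof. by exists (fun y => - x + y) => y; rewrite ?addKr ?addNKr. Qed.

(** Lagrange's argument: translation by [x] permutes [Q], so the nonzero product of all values of
    [f] is unchanged when multiplied by $f(x)^{|Q|}$. *)
Lemma mult_expr_card (K : fieldType) (Q : zmodType) (f : Q -> K) (x : Q) :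
  finite_set [set: Q] -> (forall x, f x != 0) ->
  (forall x y, f (x + y) = f x * f y) ->
  f x ^+ #|` fset_set [set: Q]|%fset = 1.
Proof.
move=> Qfin f0 fD; set P := \big[*%R/1]_(y \in [set: Q]) f y.
have P0 : P != 0 by rewrite /P fsbig_finite//= prodf_seq_neq0;
  apply/allP => y _; rewrite f0.
apply: (mulIf P0); rewrite mul1r -(fprod_const _ Qfin) -fsbig_split//=.
rewrite [RHS](reindex_fsbigT _ _ (zmod_addl_bij x)).
by apply: eq_fsbigr => y _; rewrite fD.
Qed.

Lemma char_expg_index (R : realType) (K : fieldType) (v : valuation R K)
    (G : topologicalZmodType) (H : open_subgroup G) (chi : character v G) :
  finite_set [set: {quot H}] -> (forall x, x \in H -> chi x = 1) ->
  (chi ^+ #|` fset_set [set: {quot H}]|%fset = 1)%g.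
Proof.
move=> Hfin chiH; apply: char_eq => x; rewrite charXE char1E.
rewrite -(char_reprE _ chiH).
apply: (mult_expr_card (f := chi \o repr)) => //= [y|y z].
  exact: char_neq0.
exact: char_reprD.
Qed.

(** * Evaluation at a finite level *)

Section Evaluation.
Variables (R : realType) (K : fieldType) (v : valuation R K).
Variable G : topologicalZmodType.
Hypothesis quot_finite : forall H : open_subgroup G, finite_set [set: {quot H}].
Variable nu : completed_group_ring (valring v) G.
Implicit Types (H : open_subgroup G) (chi : character v G).


Lemma valring_sum (I : Type) (r : seq I) (F : I -> valring v) :
  valring_val (\sum_(i <- r) F i) = \sum_(i <- r) valring_val (F i).
Proof. exact: (raddf_sum \val). Qed.

Definition level_eval H chi :=
  \sum_(x \in [set: {quot H}]) (nu H x : K) * chi (repr x).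

(** [chi] is constant on the fibres of $G/H\to G/H'$, along which the coefficients of [nu] add up by
    [cgr_compat]. *)
Lemma level_eval_sub H H' chi : {subset H <= H'} ->
  (forall x, x \in H' -> chi x = 1) -> level_eval H chi = level_eval H' chi.
Proof.
move=> HH' chiH'; pose q (x : {quot H}) := \pi_({quot H'}) (repr x).
rewrite /level_eval.
transitivity (\sum_(x \in [set: {quot H}]) (nu H x : K) * chi (repr (q x))).
  by apply: eq_fsbigr => x _; rewrite char_reprE.
rewrite -(fsum_fiber q (fun x => nu H x : K) (chi \o repr));
  [|exact: quot_finite..].
apply: eq_fsbigr => y _ /=; congr (_ * _).
have qy_fin : finite_set [set x | q x = y] by exact: sub_finite_set
  (quot_finite H).
by rewrite (cgr_compat nu HH') (fsbig_finite _ (nu H))// valring_sum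
  fsbig_finite.
Qed.

(** [xget] selects the value at some unknown level [H'], which is compared with [H] through their
    intersection. Its default $0$ is never returned, as [H] itself is a possible level. *)
Lemma cgr_evalE H chi :
  (forall x, x \in H -> chi x = 1) -> cgr_eval nu chi = level_eval H chi.
Proof.
move=> chiH; rewrite /cgr_eval; case: xgetP => [z _ [H' chiH' ->]|/(_
  (level_eval H chi))[]].
  have subl (H1 H2 : open_subgroup G) : {subset open_subgroupI H1 H2 <= H1} by
    move=> x /andP[].
  have subr (H1 H2 : open_subgroup G) : {subset open_subgroupI H1 H2 <= H2} by
    move=> x /andP[].
  by rewrite -[LHS]/(level_eval H' chi) -(level_eval_sub (subl H H') chiH)
    (level_eval_sub (subr H H') chiH').
by exists H.
Qed.
End Evaluation.

(** * A nonzero measure has a nonzero value *)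

Lemma card_zmod_gt0 (Q : zmodType) :
  finite_set [set: Q] -> (0 < #|` fset_set [set: Q]|%fset)%N.
Proof.
by move=> Qfin; rewrite cardfs_gt0; apply/fset0Pn; exists 0;
  rewrite in_fset_set// inE.
Qed.

(** * Common eigenvectors of the translations of a finite abelian group *)

Section EigenTranslation.
Variables (Q : zmodType) (K : closedFieldType).
Hypothesis Q_finite : finite_set [set: Q].
Let N := #|` fset_set [set: Q]|%fset.

(** The operator $T_g-z$ applied to [f], where $T_g$ is the translation by [g]. *)
Definition shiftB (g : Q) (z : K) (f : Q -> K) : Q -> K :=
  fun x => f (x + g) - z * f x.

(** The polynomial $P(T_g)$ in the translation operator, applied to [f]. *)
Definition shift_poly (g : Q) (f : Q -> K) (P : {poly K}) (x : Q) : K :=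
  \sum_(i < size P) P`_i * f (x + g *+ i).

Lemma shift_poly_widen g f (P : {poly K}) x n : (size P <= n)%N ->
  shift_poly g f P x = \sum_(i < n) P`_i * f (x + g *+ i).
Proof.
move=> Pn; rewrite /shift_poly (big_ord_widen _ (fun i => P`_i * f (x + g *+
  i)) Pn).
rewrite big_mkcond; apply: eq_bigr => i _; case: ltnP => // Pi.
by rewrite nth_default// mul0r.
Qed.

Lemma shift_polyMXsub g f (P : {poly K}) z x :
  shift_poly g f (('X - z%:P) * P) x = shiftB g z (shift_poly g f P) x.
Proof.
rewrite (@shift_poly_widen _ _ _ _ (size P).+1); last first.
  by apply: leq_trans (size_polyMleq _ _) _; rewrite size_XsubC.
rewrite /shiftB /shift_poly.
under eq_bigr do rewrite mulrBl mul_polyC coefB coefZ -commr_polyX coefMX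
  mulrBl.
rewrite sumrB; congr (_ - _).
  rewrite big_ord_recl/= mul0r add0r; apply: eq_bigr => i _ /=.
  by rewrite mulrS addrA.
rewrite big_ord_recr/= nth_default// mulr0 mul0r addr0 mulr_sumr.
by apply: eq_bigr => i _; rewrite mulrA.
Qed.

Lemma shift_poly_foldr g f r x :
  shift_poly g f (\prod_(z <- r) ('X - z%:P)) x = foldr (shiftB g) f r x.
Proof.
elim: r x => [|z r IHr] x.
  by rewrite big_nil /shift_poly size_poly1 big_ord1 coef1 mul1r addr0.
by rewrite big_cons shift_polyMXsub /shiftB/= !IHr.
Qed.

(** Translation by [g] permutes [Q], so adding $Ng$ to the sum of all elements leaves it
    unchanged. *)
Lemma mulrn_card (g : Q) : g *+ N = 0.
Proof.
have sumE : \sum_(y \in [set: Q]) y = g *+ N + \sum_(y \in [set: Q]) y.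
  rewrite {1}(reindex_fsbigT _ _ (zmod_addl_bij g)) -(fsum_const _ Q_finite).
  by rewrite -fsbig_split.
by apply: (addIr (\sum_(y \in [set: Q]) y)); rewrite add0r -sumE.
Qed.

Lemma shift_poly_Xn_sub1 g f n x : (0 < n)%N ->
  shift_poly g f ('X^n - 1) x = f (x + g *+ n) - f x.
Proof.
case: n => // n _; rewrite (@shift_poly_widen _ _ _ _ n.+2) ?size_XnsubC//.
rewrite big_ord_recr big_ord_recl/= big1 ?addr0 => [|i _].
  by rewrite !coefB !coefXn !coef1 eqxx/= sub0r subr0 mulN1r mul1r addrC.
by rewrite coefB coefXn coef1/= ltn_eqF ?subr0 ?mul0r//= /bump add1n ltnS.
Qed.

Variable V : (Q -> K) -> Prop.
Hypothesis V_shiftB : forall g z f, V f -> V (shiftB g z f).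

(** The operators $T_g-z$, applied successively, take [f] to $0$; the last nonzero function on the
    way is an eigenvector of $T_g$. As translations commute, it keeps the eigenvalues that [f]
    already had. *)
Lemma shift_eigen_foldr g f r : V f -> (exists x, f x != 0) ->
  (forall x, foldr (shiftB g) f r x = 0) ->
  exists f' z, [/\ V f', exists x, f' x != 0, forall x, f' (x + g) = z * f' x &
    forall h w, (forall x, f (x + h) = w * f x) ->
      forall x, f' (x + h) = w * f' x].
Proof.
move=> Vf f0; elim: r => [|z r IHr] rf0; first by case: f0 => x;
  rewrite -[f x]/(foldr (shiftB g) f [::] x) rf0 eqxx.
have [/IHr//|/existsNP[x fx]] := pselect (forall x, foldr (shiftB g) f r x = 0).
exists (foldr (shiftB g) f r), z; split.
- by elim: r {IHr rf0 fx} => //= y r IHr; exact: V_shiftB.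
- by exists x; exact/eqP.
- by move=> y; apply/eqP; rewrite -subr_eq0 -[_ - _]/(shiftB g z _ y);
    apply/eqP/rf0.
- move=> h w fh; elim: r {IHr rf0 fx} => //= y r IHr t.
  by rewrite /shiftB addrAC !IHr mulrBr mulrCA.
Qed.

(** Since $Ng=0$, the operator $T_g^N-1$ is zero, and $X^N-1$ splits into linear factors over
    [K]. *)
Lemma shift_eigen_step g f : V f -> (exists x, f x != 0) ->
  exists f' z, [/\ V f', exists x, f' x != 0, forall x, f' (x + g) = z * f' x &
    forall h w, (forall x, f (x + h) = w * f x) ->
      forall x, f' (x + h) = w * f' x].
Proof.
move=> Vf f0; have [r Nr] := closed_field_poly_normal ('X^N - 1 : {poly K}).
apply: (shift_eigen_foldr (r := r)) => // x.
have N_gt0 : (0 < N)%N by exact: card_zmod_gt0.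
rewrite -shift_poly_foldr; move: Nr; rewrite (monicP _) ?monicXnsubC// scale1r
  => <-.
by rewrite shift_poly_Xn_sub1// mulrn_card addr0 subrr.
Qed.

(** The elements of [Q] are treated one by one; the last clause of [shift_eigen_step] preserves what
    was achieved for the earlier ones. *)
Lemma shift_eigenvector f : V f -> (exists x, f x != 0) ->
  exists f', [/\ V f', exists x, f' x != 0 &
    forall g, exists z, forall x, f' (x + g) = z * f' x].
Proof.
move=> Vf f0; suff [f' [Vf' f'0 f'r]] : exists f', [/\ V f', exists x, f' x !=
  0 &
    forall g, g \in (fset_set [set: Q] : seq Q) ->
      exists z, forall x, f' (x + g) = z * f' x].
  by exists f'; split => // g; apply: f'r; rewrite in_fset_set// inE.
elim: (fset_set _ : seq Q) => [|g r [f1 [Vf1 f10 f1r]]]; first by exists f.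
have [f' [z [Vf' f'0 f'g f'h]]] := shift_eigen_step g Vf1 f10.
exists f'; split => // h; rewrite inE => /predU1P[->|/f1r[w fw]].
  by exists z.
by exists w; exact: f'h.
Qed.

End EigenTranslation.

Lemma finite_dual_separates (Q : zmodType) (K : closedFieldType) (f : Q -> K) :
  finite_set [set: Q] -> #|` fset_set [set: Q]|%fset%:R != 0 :> K ->
  (exists x, f x != 0) ->
  exists2 mu : Q -> K, mu 0 = 1 /\ {morph mu : x y / x + y >-> x * y} &
    \sum_(x \in [set: Q]) f x * mu x != 0.
Proof.
move=> Qfin N0 f0; apply: contrapT => nomu.
pose V (h : Q -> K) := forall mu : Q -> K, mu 0 = 1 ->
  {morph mu : x y / x + y >-> x * y} -> \sum_(x \in [set: Q]) h x * mu x = 0.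
have Vf : V f.
  move=> mu mu0 muD; apply/eqP; apply: contrapT => /negP s0.
  by apply: nomu; exists mu.
have Vshift g z h : V h -> V (shiftB g z h).
  move=> Vh mu mu0 muD.
  (* The substitution of $g+x$ for $x$ shows that pairing the translate of [h] by [g] with [mu]
     gives $\mu(-g)$ times the pairing of [h] with [mu]. *)
  have muV x : mu x = mu (- g) * mu (g + x) by rewrite -muD addKr.
  transitivity (mu (- g) * (\sum_(x \in [set: Q]) h x * mu x) -
      z * \sum_(x \in [set: Q]) h x * mu x); last by rewrite Vh// !mulr0 subrr.
  rewrite -mulNr [X in mu (- g) * X](reindex_fsbigT _ _ (zmod_addl_bij g))
    !mulr_fsumr -fsbig_split//.
  apply: eq_fsbigr => x _ /=; rewrite /shiftB mulrBl mulNr (addrC x) -mulrA.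
  by congr (_ - _); rewrite [in LHS](muV x) mulrCA.
have [h [Vh [x0 hx0] heig]] := shift_eigenvector Qfin Vshift Vf f0.
(* Normalising the common eigenvector at a point where it is nonzero gives its system of
   eigenvalues, which is a character. *)
pose mu g := h (x0 + g) / h x0.
have hE x g : h (x + g) = mu g * h x.
  by have [z hz] := heig g; rewrite /mu !hz mulfK.
have mu0 : mu 0 = 1 by rewrite /mu addr0 divff.
have muD : {morph mu : x y / x + y >-> x * y}.
  by move=> x y; apply: (mulIf hx0) => /=; rewrite -hE addrA !hE mulrCA mulrA.
(* [h] is orthogonal to the inverse of [mu]. All terms of this pairing are equal, so it is
   $|Q|\,\mu(-x_0)h(x_0)$, which cannot vanish. *)
clearbody mu; have : \sum_(x \in [set: Q]) h x * mu (- x) = 0.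
  apply: (Vh (fun x => mu (- x))) => [|x y /=]; first by rewrite oppr0.
  by rewrite opprD muD.
have -> : \sum_(x \in [set: Q]) h x * mu (- x) = \sum_(x \in [set: Q]) (mu (-
  x0) * h x0).
  apply: eq_fsbigr => x _; rewrite -{1}(subrKC x0 x) hE mulrAC -muD.
  by rewrite addrAC subrr add0r.
rewrite fsum_const// -mulr_natr => /eqP; rewrite !mulf_eq0 (negbTE N0) (negbTE
  hx0) !orbF.
move=> /eqP mux0; have : mu (x0 - x0) = mu x0 * mu (- x0) by exact: muD.
by rewrite subrr mu0 mux0 mulr0 => /eqP; rewrite oner_eq0.
Qed.

(** At a level where [nu] has a nonzero coefficient, a character of $G/H$ pairs nontrivially with
    it. Its pullback to [G] is continuous, being invariant under [H], and torsion, as $G/H$ is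
    finite. *)
Lemma cgr_eval_neq0 (R : realType) (K : closedFieldType) (v : valuation R K)
    (G : topologicalZmodType) (nu : completed_group_ring (valring v) G) :
  (forall H : open_subgroup G, finite_set [set: {quot H}]) ->
  (forall H : open_subgroup G,
     #|` fset_set [set: {quot H}]|%fset%:R != 0 :> K) ->
  cgr_nonzero nu -> exists2 chi, torsion_char chi & cgr_eval nu chi != 0.
Proof.
move=> Gfin GnatK [H [x0 nux0]].
have [|mu [mu0 muD] nu_mu] := @finite_dual_separates _ _ (fun x : {quot H} =>
  valring_val (nu H x)) (Gfin H) (GnatK H).
  by exists x0.
pose f := mu \o \pi_({quot H}).
have f0 : f 0 = 1 by rewrite /f/= raddf0.
have fD x y : f (x + y) = f x * f y by rewrite /f/= raddfD muD.
have fH x : x \in H -> f x = 1.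
  move=> xH; rewrite -f0; congr mu; apply/eqP.
  by rewrite pi_quotE subr0.
have fc : continuous (f : G -> valued v).
  by apply: (@factor_continuous _ _ _ _ H) => x y /fH fy; rewrite fD fy mulr1.
pose chi := Character f0 fD fc; have chiH : forall x, x \in H -> chi x = 1 :=
  fH.
exists chi.
  by exists #|` fset_set [set: {quot H}]|%fset; split;
    [exact: card_zmod_gt0 (Gfin H)|exact: char_expg_index (Gfin H) chiH].
rewrite (cgr_evalE _ _ chiH)// /level_eval.
move: nu_mu; congr (_ != 0); apply: eq_fsbigr => x _.
by rewrite /= /f /= reprK.
Qed.

(** * Finite subgroups of the dual *)

Lemma card_fset_setX (I J : choiceType) (A : set I) (B : set J) :
  finite_set A -> finite_set B ->
  #|` fset_set (A `*` B)|%fset = (#|` fset_set A|%fset * #|` fset_set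
    B|%fset)%N.
Proof.
move=> Afin Bfin; rewrite -sum1_size -fsbig_finite; last exact: finite_setX.
rewrite -(pair_fsbig _ (fun _ _ => 1%N))//.
have -> : \big[addn/0%N]_(j \in B) 1%N = #|` fset_set B|%fset.
  by rewrite fsbig_finite// sum1_size.
rewrite fsbig_finite//.
by rewrite big_const_seq iter_addn_0 count_predT mulnC.
Qed.

Section Subgroups.
Variables (R : realType) (K : fieldType) (v : valuation R K).
Variable G : topologicalZmodType.
Implicit Types (M : set (character v G)) (chi psi : character v G).

Lemma finite_subgroupP M : finite_subgroup M <->
  [/\ finite_set M, M 1%g & forall a b, M a -> M b -> M (a / b)%g].
Proof.
split=> [[Mfin [M1 MB]]|[Mfin M1 MB]].
  split=> // [|a b Ma Mb]; first by move: M1; rewrite inE.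
  by have := MB a b; rewrite !inE; apply.
split=> //; split; first by rewrite inE.
by move=> a b; rewrite !inE => /MB; apply.
Qed.

Lemma finite_subgroupM M a b : finite_subgroup M -> M a -> M b -> M (a * b)%g.
Proof.
move=> /finite_subgroupP[_ M1 MB] Ma Mb.
by have := MB _ _ Ma (MB _ _ M1 Mb); rewrite mul1g invgK.
Qed.

Lemma finite_subgroupV M a : finite_subgroup M -> M a -> M (a^-1)%g.
Proof. by move=> /finite_subgroupP[_ M1 MB] /(MB _ _ M1); rewrite mul1g. Qed.

Lemma finite_subgroupX M a n : finite_subgroup M -> M a -> M (a ^+ n)%g.
Proof.
move=> Mgrp Ma; elim: n => [|n IHn]; first by have [] := (finite_subgroupP M).1
  Mgrp.
by rewrite expgS; exact: finite_subgroupM.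
Qed.

Lemma finite_subgroup_mul_bij M psi : finite_subgroup M -> M psi ->
  set_bij M M (fun chi => psi * chi)%g.
Proof.
move=> Mgrp Mpsi; split.
- by move=> chi Mchi; exact: finite_subgroupM.
- by move=> chi chi' _ _ /mulgI.
- move=> chi Mchi; exists (psi^-1 * chi)%g; last by rewrite mulVKg.
  by apply: finite_subgroupM => //; exact: finite_subgroupV.
Qed.

(** Lagrange's argument at each point [x]: multiplication by [psi] permutes the factors of the
    product of the $\chi(x)$ over [M]. *)
Lemma finite_subgroup_expg_card M psi : finite_subgroup M -> M psi ->
  (psi ^+ #|` fset_set M|%fset = 1)%g.
Proof.
move=> Mgrp Mpsi; apply: char_eq => x; rewrite charXE char1E.
have Mfin := Mgrp.1.
set P := \big[*%R/1]_(chi \in M) chi x.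
have P0 : P != 0.
  by rewrite /P fsbig_finite//= prodf_seq_neq0; apply/allP => y _;
    rewrite char_neq0.
apply: (mulIf P0); rewrite mul1r -(fprod_const _ Mfin) -fsbig_split//=.
rewrite [RHS](reindex_fsbig _ _ _ _ (finite_subgroup_mul_bij Mgrp Mpsi)).
by apply: eq_fsbigr => chi _; rewrite char_mulE.
Qed.

Lemma finite_subgroup_torsion M : finite_subgroup M -> M `<=` @torsion_char _ _
  v G.
Proof.
move=> Mgrp psi Mpsi; exists #|` fset_set M|%fset.
split; last exact: finite_subgroup_expg_card.
rewrite cardfs_gt0; apply/fset0Pn; exists psi.
by rewrite in_fset_set ?inE//; exact: Mgrp.1.
Qed.

(** Orthogonality: if some [psi] in [M] has $\psi(x)\neq1$, multiplication by [psi] permutes [M], so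
    the sum is fixed by the factor $\psi(x)$ and vanishes. *)
Lemma finite_subgroup_sum M x : finite_subgroup M ->
  (\sum_(chi \in M) chi x = 0) \/ (\sum_(chi \in M) chi x = #|` fset_set
    M|%fset%:R).
Proof.
move=> Mgrp; have [M1|/existsNP[psi /not_implyP[Mpsi /eqP psix]]] :=
    pselect (forall chi, M chi -> chi x = 1).
  right; rewrite -fsum_const; last exact: Mgrp.1.
  by apply: eq_fsbigr => chi; rewrite inE; exact: M1.
left; apply/eqP; have : (psi x - 1) * \sum_(chi \in M) chi x == 0.
  rewrite mulrBl mul1r subr_eq0 mulr_fsumr eq_sym.
  apply/eqP; rewrite [LHS](reindex_fsbig _ _ _ _ (finite_subgroup_mul_bij Mgrp
    Mpsi)).
  by apply: eq_fsbigr => chi _; rewrite char_mulE.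
by rewrite mulf_eq0 subr_eq0 (negbTE psix).
Qed.

Definition char_mulset M1 M2 : set (character v G) :=
  [set (a * b)%g | a in M1 & b in M2].

Lemma finite_subgroup_mulset M1 M2 :
  finite_subgroup M1 -> finite_subgroup M2 -> finite_subgroup (char_mulset M1
    M2).
Proof.
move=> /finite_subgroupP[fin1 one1 M1B] /finite_subgroupP[fin2 one2 M2B].
apply/finite_subgroupP; split.
- exact: finite_image2.
- by exists 1%g => //; exists 1%g => //; rewrite mulg1.
- move=> _ _ [a Ma [b Mb <-]] [c Mc [d Md <-]].
  exists (a / c)%g; first exact: M1B.
  exists (b / d)%g; first exact: M2B.
  by rewrite invgM -mulgA (char_mulC (c^-1)%g) !mulgA.
Qed.

Lemma card_mulset M1 M2 : finite_subgroup M1 -> finite_subgroup M2 ->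
  M1 `&` M2 `<=` [set 1%g] ->
  #|` fset_set (char_mulset M1 M2)|%fset =
  (#|` fset_set M1|%fset * #|` fset_set M2|%fset)%N.
Proof.
move=> /finite_subgroupP[fin1 one1 M1B] /finite_subgroupP[fin2 one2 M2B] M12.
rewrite -card_fset_setX//; apply/eqP; rewrite eq_sym; apply/eqP.
apply/fcard_eq; [exact: finite_setX|exact: finite_image2|].
rewrite (_ : char_mulset M1 M2 = (fun x => x.1 * x.2)%g @` (M1 `*` M2));
  last first.
  apply/seteqP; split=> [_ [a Ma [b Mb <-]]|_ [[a b] [/= Ma Mb] <-]].
    by exists (a, b).
  by exists a => //; exists b.
rewrite card_eq_sym; apply: inj_card_eq => -[a b] [c d].
rewrite !inE => -[/= Ma Mb] [/= Mc Md] abcd.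
(* The left side lies in [M1] and the right side in [M2], so both are trivial. *)
have E : (c^-1 * a = d / b)%g.
  by apply: (mulIg b); rewrite mulgVK -mulgA abcd mulKg.
have ca : (c^-1 * a = 1)%g.
  apply: M12; split; last by rewrite E; exact: M2B.
  by rewrite char_mulC; exact: M1B.
have ac : a = c by apply: (mulgI (c^-1)%g); rewrite ca mulVg.
by congr pair => //; apply: (mulgI a); rewrite abcd ac.
Qed.

(** Here [n] is any positive exponent killing [psi], possibly larger than its order; repeated powers
    are harmless in a set. *)
Definition char_cycle psi n : set (character v G) := [set (psi ^+ i)%g | i in
  `I_n].

Lemma expg_modn psi n i : (psi ^+ n = 1)%g -> (psi ^+ (i %% n) = psi ^+ i)%g.
Proof.
by move=> psin; rewrite {2}(divn_eq i n) expgnDr mulnC expgnA psin expg1n mul1g.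
Qed.

Lemma finite_subgroup_cycle psi n : (0 < n)%N -> (psi ^+ n = 1)%g ->
  finite_subgroup (char_cycle psi n).
Proof.
move=> n_gt0 psin; apply/finite_subgroupP; split.
- exact: finite_image.
- by exists 0%N.
- move=> _ _ [i /= ilt <-] [j /= jlt <-].
  (* The exponent $i-j$ modulo [n], written without truncated subtraction of [j] from [i]. *)
  exists ((i + (n - j)) %% n)%N; first by rewrite /= ltn_mod.
  rewrite expg_modn// expgnDr; congr (_ * _)%g.
  by apply: (mulIg (psi ^+ j)%g); rewrite -expgnDr subnK ?(ltnW jlt)// psin
    mulVg.
Qed.

(** If two powers with exponents $i<j<p$ agreed, then $\psi^{j-i}=1$; as $j-i$ is prime to [p], a
    Bezout relation would give $\psi=1$. *)
Lemma card_cycle psi p : prime p -> psi <> 1%g -> (psi ^+ p = 1)%g ->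
  #|` fset_set (char_cycle psi p)|%fset = p.
Proof.
move=> p_pr psi1 psip; apply: card_fset_set; apply: inj_card_eq.
have lt_neq i j : (i < j < p)%N -> (psi ^+ i)%g <> (psi ^+ j)%g.
  move=> /andP[ij jp] E; apply: psi1.
  have psid : (psi ^+ (j - i) = 1)%g.
    by apply: (mulgI (psi ^+ i)%g); rewrite mulg1 -expgnDr subnKC ?(ltnW ij).
  have cop : coprime (j - i) p.
    rewrite coprime_sym prime_coprime// gtnNdvd ?subn_gt0//.
    exact: leq_ltn_trans (leq_subr _ _) jp.
  have ji0 : (0 < j - i)%N by rewrite subn_gt0.
  case: (egcdnP p ji0) => a b; rewrite (eqP cop) => ab _.
  have := congr1 (fun k => psi ^+ k)%g ab.
  by rewrite mulnC expgnA psid expg1n addn1 expgS mulnC expgnA psip expg1n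
    mulg1.
move=> i j; rewrite !inE/= => ip jp E; case: (ltngtP i j) => // lt.
  by case: (@lt_neq i j); rewrite ?lt.
by case: (@lt_neq j i); rewrite ?lt.
Qed.

Lemma finite_subgroup_prime_order M p : finite_subgroup M -> M <> [set 1%g] ->
  (forall chi, M chi -> exists n, (chi ^+ (p ^ n) = 1)%g) ->
  exists psi, [/\ M psi, psi <> 1%g & (psi ^+ p = 1)%g].
Proof.
move=> Mgrp M1 Mp.
have [psi [Mpsi psi1]] : exists psi, M psi /\ psi <> 1%g.
  apply: contrapT => noM; apply: M1; apply/seteqP; split=> [psi Mpsi|_ ->].
    by apply: contrapT => psi1; apply: noM; exists psi.
  by have [] := (finite_subgroupP M).1 Mgrp.
have ex : exists n, (psi ^+ (p ^ n) == 1)%g.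
  by have [n psin] := Mp _ Mpsi; exists n; apply/eqP.
(* With $p^{n+1}$ the least power of [p] killing [psi], the character $\psi^{p^n}$ has order [p].
   Exponent $0$ is excluded because [psi] is nontrivial. *)
case: (ex_minnP ex) => [[|n]] /eqP psin nmin; first by rewrite expg1 in psin.
exists (psi ^+ (p ^ n))%g; split.
- exact: finite_subgroupX.
- by move=> /eqP /nmin; rewrite ltnn.
- by rewrite -expgnA -expnSr.
Qed.

End Subgroups.

(** * The maximal avoiding subgroup *)

Section CharacterSums.
Variables (R : realType) (K : fieldType) (v : valuation R K) (p : nat).
Variable G : topologicalZmodType.
Hypothesis p_prime : prime p.
Hypothesis vp : v p%:R = 1%E.
Hypothesis G_index : forall H : open_subgroup G,
  exists n, ([set: {quot H}] #= `I_(p ^ n))%card.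
Variable nu : completed_group_ring (valring v) G.
Implicit Types (M : set (character v G)) (chi psi : character v G).

Let G_finite (H : open_subgroup G) : finite_set [set: {quot H}].
Proof. by apply/finite_setP; have [n Hn] := G_index H; exists (p ^ n)%N. Qed.

Let natK_neq0 n : (0 < n)%N -> n%:R != 0 :> K.
Proof. exact: (nat_neq0_val vp p_prime). Qed.

Lemma torsion_char_p_order chi : torsion_char chi ->
  exists n, (chi ^+ (p ^ n) = 1)%g.
Proof.
move=> /(torsion_char_open_ker natK_neq0)[H chiH].
have [n Hn] := G_index H; exists n.
by rewrite -(card_fset_set Hn); exact: char_expg_index (G_finite H) chiH.
Qed.

Lemma val_torsion_char chi x : torsion_char chi -> v (chi x) = 0%E.
Proof.
move=> [n [n_gt0 chin]]; apply: (val_unity_root v n_gt0).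
by rewrite -charXE chin.
Qed.

Lemma torsion_charM chi psi :
  torsion_char chi -> torsion_char psi -> torsion_char (chi * psi)%g.
Proof.
move=> [m [m0 chim]] [n [n0 psin]]; exists (m * n)%N; split;
  first by rewrite muln_gt0 m0.
apply: char_eq => x; rewrite charXE char_mulE exprMn -!charXE.
by rewrite expgnA chim expg1n mulnC expgnA psin expg1n char1E mulr1.
Qed.

Lemma val_cgr_eval_ge0 chi : torsion_char chi -> (0 <= v (cgr_eval nu chi))%E.
Proof.
move=> chitor; have [H chiH] := torsion_char_open_ker natK_neq0 chitor.
rewrite (cgr_evalE G_finite _ chiH); apply: val_fsum_ge => x _.
rewrite valM (val_torsion_char _ chitor) adde0.
exact: (valring_valP (nu H x)).
Qed.

Lemma cgr_val_ge0 : (0 <= cgr_val nu)%E.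
Proof.
by apply: le_ereal_inf_tmp => _ [chi chitor <-]; exact: val_cgr_eval_ge0.
Qed.

(** After exchanging the sums, the inner sum over [M] is $0$ or $p^k$ by orthogonality, and it is
    multiplied by integral elements. *)
Lemma val_subgroup_sum M k psi : finite_subgroup M ->
  #|` fset_set M|%fset = (p ^ k)%N -> torsion_char psi ->
  (k%:R%:E <= v (\sum_(chi \in M) cgr_eval nu (chi * psi)%g)%R)%E.
Proof.
move=> Mgrp Mk psitor.
have M'tor : [set (chi * psi)%g | chi in M] `<=` @torsion_char _ _ v G.
  by move=> _ [chi Mchi <-]; apply: torsion_charM => //;
    exact: finite_subgroup_torsion Mchi.
have [H HM] := common_open_ker natK_neq0 (finite_image _ Mgrp.1) M'tor.
have -> : \sum_(chi \in M) cgr_eval nu (chi * psi)%g =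
    \sum_(x \in [set: {quot H}])
      (nu H x : K) * psi (repr x) * \sum_(chi \in M) chi (repr x).
  transitivity (\sum_(chi \in M) \sum_(x \in [set: {quot H}])
      (nu H x : K) * (chi (repr x) * psi (repr x))).
    apply: eq_fsbigr => chi; rewrite inE => Mchi.
    have chiH x : x \in H -> (chi * psi)%g x = 1 by apply: HM; exists chi.
    by rewrite (cgr_evalE G_finite _ chiH).
  rewrite exchange_fsbig; [|exact: Mgrp.1|exact: G_finite].
  apply: eq_fsbigr => x _; rewrite mulr_fsumr; apply: eq_fsbigr => chi _.
  by rewrite mulrA mulrAC.
apply: val_fsum_ge => x _; rewrite !valM (val_torsion_char _ psitor) adde0.
rewrite -[leLHS]add0e; apply: leeD; first exact: (valring_valP (nu H x)).
have [->|->] := finite_subgroup_sum (repr x) Mgrp; first by rewrite val0 leey.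
by rewrite Mk (val_pX vp).
Qed.

Section Avoiding.
Variables (psi : character v G) (c : \bar R).
Hypothesis psi_torsion : torsion_char psi.
Hypothesis nu_psi_le : (v (cgr_eval nu psi) <= c)%E.
Hypothesis c_fin : (c < +oo)%E.

Definition avoiding M := forall chi, M chi -> chi <> 1%g ->
  (c < v (cgr_eval nu (chi * psi)%g))%E.

Lemma avoiding_bound M k : finite_subgroup M ->
  #|` fset_set M|%fset = (p ^ k)%N -> avoiding M ->
  (k%:R%:E <= v (cgr_eval nu psi))%E.
Proof.
move=> Mgrp Mk Mavoid; rewrite leNgt; apply/negP => nu_lt.
have M1 : M 1%g by have [] := (finite_subgroupP M).1 Mgrp.
have sumE : \sum_(chi \in M) cgr_eval nu (chi * psi)%g =
    cgr_eval nu psi + \sum_(chi \in M `\ 1%g) cgr_eval nu (chi * psi)%g.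
  by rewrite (fsbigD1 1%g) ?mul1g//; exact: Mgrp.1.
have rest_gt : (v (cgr_eval nu psi) <
    v (\sum_(chi \in M `\ 1%g) cgr_eval nu (chi * psi)%g)%R)%E.
  apply: val_fsum_gt; first exact: le_lt_trans nu_psi_le c_fin.
  by move=> chi [/= Mchi chi1]; apply: le_lt_trans nu_psi_le _; exact: Mavoid.
have sum_gt := lt_le_trans nu_lt (val_subgroup_sum Mgrp Mk psi_torsion).
(* $\nu(\psi)$ is the total minus the remaining terms, both of valuation larger than its own. *)
by have := valB_gt sum_gt rest_gt; rewrite sumE addrK ltxx.
Qed.

Lemma avoiding_extend M0 k M : finite_subgroup M0 ->
  #|` fset_set M0|%fset = (p ^ k)%N -> avoiding M0 ->
  finite_subgroup M -> M <> [set 1%g] ->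
  (forall chi chi0, M chi -> chi <> 1%g -> M0 chi0 ->
    (c < v (cgr_eval nu (chi * chi0 * psi)%g))%E) ->
  exists M', [/\ finite_subgroup M', #|` fset_set M'|%fset = (p ^ k.+1)%N &
    avoiding M'].
Proof.
move=> M0grp M0k M0avoid Mgrp M1 Mbad.
have [|phi [Mphi phi1 phip]] := finite_subgroup_prime_order (p := p) Mgrp M1.
  by move=> chi Mchi; apply: torsion_char_p_order;
    exact: finite_subgroup_torsion Mchi.
have Cgrp := finite_subgroup_cycle (prime_gt0 p_prime) phip.
have CM : char_cycle phi p `<=` M by move=> _ [i _ <-]; exact: finite_subgroupX.
exists (char_mulset (char_cycle phi p) M0); split.
- exact: finite_subgroup_mulset.
- rewrite card_mulset// ?M0k ?(card_cycle p_prime)// ?expnS//.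
  move=> a [/CM Ma M0a]; apply: contrapT => a1.
  (* A nontrivial [a] in the intersection, taken with its inverse in [M0], would give
     $v(\nu(\psi))>c$. *)
  have := Mbad _ _ Ma a1 (finite_subgroupV M0grp M0a).
  by rewrite mulgV mul1g ltNge nu_psi_le.
- move=> _ [a /CM Ma [b M0b <-]] ab1.
  have [a1|] := pselect (a = 1%g); last by move=> a1; exact: Mbad.
  by move: ab1; rewrite a1 mul1g => b1; exact: M0avoid.
Qed.

Lemma maximal_avoiding : exists M0 k,
  [/\ finite_subgroup M0, #|` fset_set M0|%fset = (p ^ k)%N,
      (k%:R%:E <= v (cgr_eval nu psi))%E &
      forall M, finite_subgroup M -> M <> [set 1%g] ->
        exists chi chi0, [/\ M chi, chi <> 1%g, M0 chi0 &
          (v (cgr_eval nu (chi * chi0 * psi)%g) <= c)%E]].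
Proof.
apply: contrapT => nomax.
(* Without a subgroup as required, every avoiding subgroup can be enlarged, starting from the
   trivial one, so all orders $p^k$ occur. *)
have ladder k : exists M0,
    [/\ finite_subgroup M0, #|` fset_set M0|%fset = (p ^ k)%N & avoiding M0].
  elim: k => [|k [M0 [M0grp M0k M0avoid]]].
    exists [set 1%g]; split; last by move=> chi ->.
      by apply/finite_subgroupP; split => // _ _ -> ->; rewrite mulgV.
    by rewrite fset_set1 cardfs1.
  have [M /not_implyP[Mgrp /not_implyP[M1 Mbad]]] : exists M,
      ~ (finite_subgroup M -> M <> [set 1%g] ->
        exists chi chi0, [/\ M chi, chi <> 1%g, M0 chi0 &
          (v (cgr_eval nu (chi * chi0 * psi)%g) <= c)%E]).
    apply/existsNP => Mgood; apply: nomax; exists M0, k; split => //.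
    exact: avoiding_bound M0k M0avoid.
  apply: (avoiding_extend M0grp M0k M0avoid Mgrp M1) => chi chi0 Mchi chi1
    M0chi0.
  by rewrite ltNge; apply/negP => good; apply: Mbad; exists chi, chi0.
have nu_fin : v (cgr_eval nu psi) \is a fin_num.
  by rewrite ge0_fin_numE ?val_cgr_eval_ge0//;
    exact: le_lt_trans nu_psi_le c_fin.
(* The exponent is a natural number exceeding $v(\nu(\psi))$, which contradicts [avoiding_bound]. *)
have [M0 [M0grp M0k M0avoid]] := ladder (Num.bound (fine (v (cgr_eval nu
  psi)))).
have := avoiding_bound M0grp M0k M0avoid.
rewrite -(fineK nu_fin) lee_fin leNgt => /negP; apply.
by rewrite archi_boundP// fine_ge0// val_cgr_eval_ge0.
Qed.

End Avoiding.
End CharacterSums.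

Theorem theorem2p8 (R : realType) (p : nat) (p_prime : prime p)
    (Cp : closedFieldType) (v : valuation R Cp) (HCp : is_padic_complex v p)
    (G : topologicalZmodType) (HG : pro_p p G)
    (nu : completed_group_ring (valring v) G) (nu_neq0 : cgr_nonzero nu)
    (eps : R) (eps_gt0 : 0 < eps) :
  let admissible (M0 : set (character v G)) :=
    finite_subgroup M0 /\
    forall M : set (character v G), finite_subgroup M -> M <> [set 1%g] ->
      exists chi chi0 : character v G,
        [/\ M chi, chi <> 1%g, M0 chi0 &
            (v (cgr_eval nu (chi * chi0)%g) <= cgr_val nu + eps%:E)%E] in
  (exists M0, admissible M0) /\
  ((v (cgr_eval nu 1%g) <= cgr_val nu + eps%:E)%E ->
   exists M0, admissible M0 /\
     (#|` fset_set M0|%fset%:R <= p%:R ^ Num.floor (fine (v (cgr_eval nu 1%g))) :> R)).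
Proof.
move=> admissible.
have vp := padic_val_p HCp; have G_index := pro_p_index HG.
have G_finite (H : open_subgroup G) : finite_set [set: {quot H}].
  by apply/finite_setP; have [n Hn] := G_index H; exists (p ^ n)%N.
have G_card (H : open_subgroup G) : #|` fset_set [set: {quot H}]|%fset%:R != 0
  :> Cp.
  by apply: (nat_neq0_val vp p_prime); exact: card_zmod_gt0 (G_finite H).
have [chi chitor nuchi] := cgr_eval_neq0 G_finite G_card nu_neq0.
have nu_ge0 := cgr_val_ge0 p_prime vp G_index nu.
have nu_ltoo : (cgr_val nu < +oo)%E.
  have chi_fin : (v (cgr_eval nu chi) < +oo)%E by rewrite ltey_eq val_fin.
  by apply: le_lt_trans chi_fin; apply: ereal_inf_lbound; exists chi.
have nu_fin : cgr_val nu \is a fin_num by rewrite ge0_fin_numE.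
have c_fin : (cgr_val nu + eps%:E < +oo)%E by rewrite lte_add_pinfty// ltry.
split.
  (* Finiteness of the infimum makes this strict, so some torsion [psi] has a value below the
     right-hand side. *)
  have : (cgr_val nu < cgr_val nu + eps%:E)%E by rewrite lteDl// lte_fin.
  move=> /ereal_inf_lt[_ [psi psitor <-] /ltW psi_le].
  have [M0 [k [M0grp _ _ M0P]]] := maximal_avoiding p_prime vp G_index psitor
    psi_le c_fin.
  have [n [n_gt0 psin]] := psitor.
  exists (char_mulset M0 (char_cycle psi n)); split.
    by apply: finite_subgroup_mulset => //; exact: finite_subgroup_cycle.
  move=> M Mgrp M1; have [phi [phi0 [Mphi phi1 M0phi0 le]]] := M0P M Mgrp M1.
  (* The shift by [psi] is absorbed into the second factor, which is why [M0] was enlarged by the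
     powers of [psi]. *)
  exists phi, (phi0 * psi)%g; split => //; last by rewrite mulgA.
  (* The exponent is $1$ modulo [n] because $1$ itself is out of range when $n=1$. *)
  exists phi0 => //; exists psi => //; exists (1 %% n)%N;
    first by rewrite /= ltn_mod.
  by rewrite expg_modn.
have onetor : torsion_char (1%g : character v G) by exists 1%N.
move=> one_le.
have [M0 [k [M0grp M0k k_le M0P]]] := maximal_avoiding p_prime vp G_index
  onetor one_le c_fin.
exists M0; split.
  split=> // M Mgrp M1; have [phi [phi0 [Mphi phi1 M0phi0 le]]] := M0P M Mgrp
    M1.
  by exists phi, phi0; split => //; rewrite mulg1 in le.
have one_fin : v (cgr_eval nu 1%g) \is a fin_num.
  rewrite ge0_fin_numE; first exact: le_lt_trans one_le c_fin.
  exact: (val_cgr_eval_ge0 p_prime vp G_index nu onetor).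
(* As [k] is an integer, $k\leq v(\nu(\mathbf{1}))$ already bounds it by the floor; finiteness of
   the valuation lets [fine] return its true value. *)
rewrite M0k natrX exprnP ler_weXz2l//; last first.
  by rewrite floor_ge_int -lee_fin fineK.
by rewrite ler1n prime_gt0.
Qed.
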